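(* Let $\mu$ be a locally finite positive Borel measure on $\mathbb{R}$ with $\mu(I)>0$ for all $I\in\mathcal{D}$, and let $\alpha>0$. If all dyadic (Haar) shifts $T$ are uniformly bounded on $\Lambda_2(\alpha)$, then $\mu$ is balanced. The same is true with $\Lambda_2(\alpha)$ replaced by $\mathrm{BMO}(\mu)$: if all dyadic shifts are uniformly bounded on $\mathrm{BMO}(\mu)$, then $\mu$ is balanced.
   Context: $\mathcal{D}=\{2^{-k}[\ell,\ell+1):k,\ell\in\mathbb{Z}\}$ is the standard dyadic lattice on $\mathbb{R}$, $\mathcal{D}_k$ the intervals of length $2^{-k}$; for $I\in\mathcal{D}$, $\widehat I$ is its dyadic parent, $I^{(N)}$ its $N$-th dyadic ancestor, and $I_-,I_+$ its left and right halves. $\langle f\rangle_I=\mu(I)^{-1}\int_I f\,d\mu$ and $\langle f,g\rangle=\int fg\,d\mu$. Balanced: with $m(I)=\min\{\mu(I_-),\mu(I_+)\}$, $\mu$ is balanced if there is a constant $c\ge1$ with $c^{-1}m(\widehat I)\le m(I)\le c\,m(\widehat I)$ for all $I\in\mathcal{D}$. Haar functions: $h_I=\sqrt{\dfrac{\mu(I_-)\mu(I_+)}{\mu(I)}}\Big(\dfrac{\mathbf{1}_{I_-}}{\mu(I_-)}-\dfrac{\mathbf{1}_{I_+}}{\mu(I_+)}\Big)$. Dyadic shifts: for $I\in\mathcal{D}$ and an integer $m\ge0$ let $I_m^s$, $0\le s<2^m$, enumerate from left to right the $2^m$ dyadic subintervals of $I$ of length $2^{-m}|I|$. For integers $m,n\ge0$,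 $0\le s<2^m$, $0\le t<2^n$, a dyadic shift is $$Tf=\sum_{I\in\mathcal{D}}\alpha_I\langle f,h_{I_m^s}\rangle h_{I_n^t},\qquad \sup_{I\in\mathcal{D}}|\alpha_I|\le1 ,$$ which is bounded on $L^2(\mu)$. For $f\in L^2_{\mathrm{loc}}(\mu)$ (in particular for $f$ in $\Lambda_2(\alpha)$ or, by the John–Nirenberg inequality, in $\mathrm{BMO}(\mu)$), $Tf$ denotes the function, determined up to adding a function constant on each of $[0,\infty)$ and $(-\infty,0)$, such that for every $I_0\in\mathcal{D}$ the difference $Tf-T\big(f\mathbf{1}_{I_0^{(m+n)}}\big)$ is $\mu$-a.e. constant on $I_0$. Spaces: $\Lambda_2(\alpha)$ is the space of $f\in L^2_{\mathrm{loc}}(\mu)$ with $\|f\|_{\Lambda_2(\alpha)}=\sup_{I\in\mathcal{D}}\mu(I)^{-1/2-\alpha}\big(\int_I|f-\langle f\rangle_{\widehat I}|^2d\mu\big)^{1/2}<\infty$. $\mathrm{BMO}(\mu)$ is the space of locally $\mu$-integrable $f$ with $\|f\|_{\mathrm{BMO}}=\sup_{k\in\mathbb{Z}}\|\mathsf{E}_k|f-\mathsf{E}_{k-1}f|\|_{L^\infty(\mu)}<\infty$, where $\mathsf{E}_kf=\sum_{I\in\mathcal{D}_k}\langle f\rangle_I\mathbf{1}_I$. ''All dyadic shifts are uniformly bounded on $X$'' means: for each choice of $(m,n,s,t)$ there is a constant $C<\infty$ such that $\|Tf\|_X\le C\|f\|_X$ for all $f\in X$ and all dyadic shifts $T$ with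 these parameters and coefficients $|\alpha_I|\le1$. *)

(* Defs.v *)
From mathcomp Require Import all_boot all_order all_algebra finmap.
From mathcomp Require Import all_classical all_reals all_analysis.
From mathcomp Require Import summability.

Set Implicit Arguments.
Unset Strict Implicit.
Unset Printing Implicit Defensive.

Import Order.TTheory GRing.Theory Num.Theory.
Import numFieldNormedType.Exports.

Local Open Scope classical_set_scope.
Local Open Scope ring_scope.

(* The pair (k, l) stands for the interval 2^-k [l, l + 1); every dyadic       *)
(* interval comes from exactly one pair.                                       *)
Notation dyadic := (int * int)%type.

(* The s-th (from left to right, from 0) of the 2^m dyadic subintervals of I   *)
(* of length 2^-m |I|.                                                         *)
Definition dsub (m s : nat) (I : dyadic) : dyadic :=
  (I.1 + m%:Z, I.2 * (2 ^ m)%N%:Z + s%:Z).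

Definition dleft (I : dyadic) : dyadic := dsub 1 0 I.
Definition dright (I : dyadic) : dyadic := dsub 1 1 I.

(* %/ rounds towards -oo here, also for negative I.2.                          *)
Definition dparent (I : dyadic) : dyadic := (I.1 - 1, (I.2 %/ 2)%Z).
Definition dancestor (N : nat) (I : dyadic) : dyadic := iter N dparent I.

Section Dyadic.
Variable R : realType.

Definition ditv (I : dyadic) : set R :=
  `[2 ^ (- I.1) * I.2%:~R, 2 ^ (- I.1) * (I.2 + 1)%:~R[%classic.

(* The dyadic interval of length 2^-k containing x.                            *)
Definition dyadic_at (k : int) (x : R) : dyadic :=
  (k, Num.floor (2 ^ k * x)).

Variable mu : {measure set (measurableTypeR R) -> \bar R}.

Definition locally_finite : Prop :=
  forall x : R, exists2 U : set R, open_nbhs x U & (mu U < +oo)%E.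

(* Finite as soon as mu is locally finite, so that fine loses nothing.         *)
Definition dmass (I : dyadic) : R := fine (mu (ditv I)).

Definition dmin (I : dyadic) : R := Num.min (dmass (dleft I)) (dmass (dright I)).

Definition balanced : Prop :=
  exists2 c : R, 1 <= c &
    forall I : dyadic,
      c^-1 * dmin (dparent I) <= dmin I /\ dmin I <= c * dmin (dparent I).

Definition avg (f : R -> R) (I : dyadic) : R :=
  (dmass I)^-1 * \int[mu]_(x in ditv I) f x.

Definition inner (f g : R -> R) : R := \int[mu]_x (f x * g x).

Definition haar (I : dyadic) (x : R) : R :=
  Num.sqrt (dmass (dleft I) * dmass (dright I) / dmass I) *
  (\1_(ditv (dleft I)) x / dmass (dleft I) -
   \1_(ditv (dright I)) x / dmass (dright I)).

(* The terms of the shift indexed by the finite set of intervals J.            *)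
Definition shift_sum (m n s t : nat) (a : dyadic -> R) (f : R -> R)
    (J : {fset dyadic}) (x : R) : R :=
  \sum_(I <- J) a I * inner f (haar (dsub m s I)) * haar (dsub n t I) x.

(* u is (a representative of) T f for f in L^2(mu): the series over all dyadic *)
(* intervals converges to u unconditionally in L^2(mu).                        *)
Definition is_shift_L2 (m n s t : nat) (a : dyadic -> R) (f u : R -> R) : Prop :=
  [/\ f \in Lfun mu 2%:E, u \in Lfun mu 2%:E &
      'N[mu]_2%:E[EFin \o (u \- shift_sum m n s t a f J)%R]%E
        @[J --> totally] --> 0%E].

(* g is a version of T f for f in L^2_loc(mu).  T f is only determined up to   *)
(* functions constant on [0, oo) and on (-oo, 0), whence a relation.           *)
Definition is_shift (m n s t : nat) (a : dyadic -> R) (f g : R -> R) : Prop :=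
  measurable_fun [set: measurableTypeR R] g /\
  forall I0 : dyadic, exists2 u : R -> R,
    is_shift_L2 m n s t a (f \_ (ditv (dancestor (m + n) I0))) u &
    exists c : R, {ae mu, forall x, ditv I0 x -> g x - u x = c}.

Definition L2loc : set (R -> R) := [set f : R -> R | measurable_fun [set: measurableTypeR R] f /\
  forall K : set R, compact K -> (\int[mu]_(x in K) (`|f x| ^+ 2)%:E < +oo)%E].

Definition L1loc : set (R -> R) := [set f : R -> R | measurable_fun [set: measurableTypeR R] f /\
  forall K : set R, compact K -> (\int[mu]_(x in K) `|f x|%:E < +oo)%E].

Definition Lambda2_norm (alpha : R) (f : R -> R) : \bar R :=
  ereal_sup (range (fun I : dyadic =>
    ((dmass I `^ (- 2^-1 - alpha))%:E *
     (\int[mu]_(x in ditv I) (`|f x - avg f (dparent I)| ^+ 2)%:E) `^ 2^-1)%E)).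

Definition Lambda2 (alpha : R) : set (R -> R) :=
  [set f | L2loc f /\ (Lambda2_norm alpha f < +oo)%E].

Definition condE (k : int) (f : R -> R) (x : R) : R := avg f (dyadic_at k x).

Definition BMO_norm (f : R -> R) : \bar R :=
  ereal_sup (range (fun k : int =>
    'N[mu]_+oo[EFin \o condE k (fun x => `|f x - condE (k - 1) f x|)%R]%E)).

Definition BMO : set (R -> R) :=
  [set f | L1loc f /\ (BMO_norm f < +oo)%E].

Definition shifts_uniformly_bounded
    (X : set (R -> R)) (normX : (R -> R) -> \bar R) : Prop :=
  forall m n s t : nat, (s < 2 ^ m)%N -> (t < 2 ^ n)%N ->
  exists C : R, forall a : dyadic -> R, (forall I, `|a I| <= 1) ->
  forall f g : R -> R, X f -> is_shift m n s t a f g ->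
    (normX g <= C%:E * normX f)%E.

End Dyadic.

(* Main.v *)
Require Import Defs.
From mathcomp Require Import all_boot all_order all_algebra finmap.
From mathcomp Require Import all_classical all_reals all_analysis.
From mathcomp Require Import measurable_realfun ess_sup_inf summability zify ring lra.

Set Implicit Arguments.
Unset Strict Implicit.
Unset Printing Implicit Defensive.

Import Order.TTheory GRing.Theory Num.Theory.
Import numFieldNormedType.Exports.

Local Open Scope classical_set_scope.
Local Open Scope ring_scope.

(** The proof tests the boundedness of two very simple families of shifts on
    Haar functions.  Write m(J) for the smaller of the masses of the halves of J.

    The Haar function h_J is comparable in absolute value to m(J)^(-1/2) on the
    lighter half of J, is at most m(J)^(-1/2) everywhere, and has mean zero on
    every dyadic interval that contains J.  Both norms only see the differences
    f - <f>_P on the children of a dyadic P.  Such a difference of h_J is zero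
    unless P contains J; in that case the mean over P vanishes, and a child of P
    that meets J contains a half of J, so that its mass is at least m(J).
    Consequently
      2^(-1/2) m(J)^(-p) <= ||h_J|| <= m(J)^(-p)
    with p = 1/2 + alpha for Lambda_2(alpha) and p = 1/2 for BMO (see
    [haar_Lambda2_norm_ge], [haar_Lambda2_norm_le], [haar_BMO_norm_ge] and
    [haar_BMO_norm_le]).

    A shift with a single nonzero coefficient, equal to 1 at I, maps the Haar
    function of I_m^s to that of I_n^t ([single_term_shift_haar]).  A uniform
    bound for these shifts, tested on Haar functions, therefore gives
    m(I_m^s) <= K m(I_n^t) for all I ([dmin_compare]).  The complexities
    (m, n) = (0, 1) and (1, 0) compare m(I) with m of its parent in both
    directions, and this is balancedness ([bounded_on_haar_balanced]). *)

(** * Nestedness of dyadic intervals *)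

Section DyadicIntervals.
Variable R : realType.
Implicit Types (I J K : dyadic) (x y : R).
Local Notation ditv := (@ditv R).

(** Membership in I becomes an equation about the floor function, so that
    nestedness can be settled by integer arithmetic on indices. *)
Lemma ditvE I x : ditv I x <-> dyadic_at I.1 x = I.
Proof.
have h k : 0 < (2 : R) ^ k by exact: exprz_gt0.
have eq2 (z : R) : (2 ^ (- I.1) * z <= x) = (z <= 2 ^ I.1 * x).
  by rewrite -invr_expz mulrC ler_pdivrMr// mulrC.
have eq2' (z : R) : (x < 2 ^ (- I.1) * z) = (2 ^ I.1 * x < z).
  by rewrite -invr_expz [X in _ < X]mulrC ltr_pdivlMr// mulrC.
rewrite /ditv /= in_itv /= eq2 eq2' -floor_eq.
case: I {eq2 eq2'} => k l /=; rewrite /dyadic_at /=.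
by split=> [/eqP <-//|[->]].
Qed.

Lemma dyadic_at_parent k x : dparent (dyadic_at k x) = dyadic_at (k - 1) x.
Proof.
rewrite /dparent /dyadic_at /=; congr pair; symmetry; apply: floor_def.
have -> : (2 : R) ^ (k - 1) * x = 2 ^ k * x / 2.
  by rewrite expfzDr ?pnatr_eq0// exprN1; ring.
move: (2 ^ k * x) => z {x}.
have := floor_itv z; set f := Num.floor z; have := divz_eq f 2.
have : (0 <= f %% 2 < 2)%Z by lia.
set q := (f %/ 2)%Z; set r := (f %% 2)%Z => hr ->.
have [->|->] : r = 0 \/ r = 1 by lia.
  by rewrite !(intrD, intrM) /= => ?; lra.
by rewrite !(intrD, intrM) /= => ?; lra.
Qed.

Lemma dyadic_at_ancestor k x n :
  dyadic_at (k - n%:Z) x = iter n dparent (dyadic_at k x).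
Proof.
elim: n => [|n IH] /=; first by rewrite subr0.
by rewrite -IH dyadic_at_parent; congr dyadic_at; lia.
Qed.

(** The interval of a coarse level around a point is an iterated parent of the
    one of a finer level, hence is determined by it. *)
Lemma ditv_nested I J x y : I.1 <= J.1 ->
  ditv I x -> ditv J x -> ditv J y -> ditv I y.
Proof.
move=> IJ /ditvE xI /ditvE xJ /ditvE yJ; apply/ditvE.
have anc (z : R) : dyadic_at I.1 z = iter (absz (J.1 - I.1)) dparent (dyadic_at J.1 z).
  by rewrite -dyadic_at_ancestor; congr (dyadic_at _ z); lia.
by rewrite anc yJ -xJ -anc.
Qed.

Lemma ditv_parent I : ditv I `<=` ditv (dparent I).
Proof. by move=> x /ditvE xI; apply/ditvE; rewrite -dyadic_at_parent xI. Qed.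

Lemma ditv_ancestor N I : ditv I `<=` ditv (dancestor N I).
Proof.
elim: N => [|N IH]; first exact: subset_refl.
by apply: subset_trans IH _; exact: ditv_parent.
Qed.

Lemma dancestor_level N I : (dancestor N I).1 = I.1 - N%:Z.
Proof. by elim: N => [|N IH] /=; rewrite ?subr0// IH; lia. Qed.

Lemma dyadic_at_mem k x : ditv (dyadic_at k x) x.
Proof. exact/ditvE. Qed.

Lemma ditv_nonempty I : exists x, ditv I x.
Proof.
have h : 0 < (2 : R) ^ (- I.1) by exact: exprz_gt0.
exists (2 ^ (- I.1) * I.2%:~R); rewrite /ditv /= in_itv/= lexx/=.
by rewrite ltr_pM2l// ltr_int; lia.
Qed.

Lemma dparent_dsub I s : (s < 2)%N -> dparent (dsub 1 s I) = I.
Proof.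
move=> s2; case: I => k l; rewrite /dparent /dsub /=; congr pair; first by lia.
rewrite expn1; lia.
Qed.

Lemma dsub_dparent I : exists2 s, (s < 2)%N & I = dsub 1 s (dparent I).
Proof.
exists (absz (I.2 %% 2)%Z); first by lia.
by case: I => k l; rewrite /dparent /dsub /= expn1; congr pair; lia.
Qed.

Lemma ditv_halves I : ditv I = ditv (dleft I) `|` ditv (dright I).
Proof.
apply/seteqP; split => x; last first.
  by case => /ditv_parent; rewrite dparent_dsub.
move=> /ditvE xI; have [s s2 e] := dsub_dparent (dyadic_at (I.1 + 1) x).
have := @dyadic_at_mem (I.1 + 1) x; rewrite e dyadic_at_parent addrK xI.
by case: s s2 {e} => [|[|//]] _ ?; [left|right].
Qed.

Lemma ditv_halves_disj I x : ditv (dleft I) x -> ditv (dright I) x -> False.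
Proof.
by move=> /ditvE/(congr1 snd) + /ditvE/(congr1 snd) => /= -> /=; lia.
Qed.

End DyadicIntervals.

(** * Masses of dyadic intervals *)

Lemma locally_finite_compact (R : realType)
    (mu : {measure set (measurableTypeR R) -> \bar R}) (K : set R) :
  locally_finite mu -> compact K -> (mu K < +oo)%E.
Proof.
move=> fin_mu cK; have := cK; rewrite compact_cover.
have fin_mu' (x : R) : exists U, open_nbhs x U /\ (mu U < +oo)%E.
  by have [U] := fin_mu x; exists U.
have [V V_prop] := choice fin_mu'.
have oV x : open (V x) by have [[]] := V_prop x.
move=> /(_ R setT V) [//||D _ KD].
  by move=> x _; exists x => //; have [[]] := V_prop x.
have mK : measurable (K : set (measurableTypeR R)).
  by apply: closed_measurable; exact: compact_closed.
have mV x : measurable (V x : set (measurableTypeR R)) by exact: open_measurable.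
apply: le_lt_trans (content_sub_fsum mu (finite_fset D) (fun x _ => mV x) mK KD) _.
rewrite fsbig_finite ?finite_fset//= lte_sum_pinfty// => x _.
by have [] := V_prop x.
Qed.

Section HaarFunctions.
Variables (R : realType) (mu : {measure set (measurableTypeR R) -> \bar R}).
Hypotheses (mu_locally_finite : locally_finite mu)
  (mu_dyadic_gt0 : forall I : dyadic, (0 < mu (ditv I))%E).
Implicit Types (I J K : dyadic) (x y : R).
Local Notation ditv := (@ditv R).
Local Notation dmass := (dmass mu).
Local Notation dmin := (dmin mu).
Local Notation haar := (haar mu).

Lemma measurable_ditv I : measurable (ditv I : set (measurableTypeR R)).
Proof. exact: measurable_itv. Qed.

Lemma mu_ditv_lty I : (mu (ditv I) < +oo)%E.
Proof.
apply: (@le_lt_trans _ _ (mu `[2 ^ (- I.1) * I.2%:~R, 2 ^ (- I.1) * (I.2 + 1)%:~R]%classic)).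
  apply: le_measure; rewrite ?inE.
  - exact: measurable_ditv.
  - exact: measurable_itv.
  - by move=> x; rewrite /Defs.ditv /= !in_itv/= => /andP[-> /ltW].
by apply: locally_finite_compact => //; exact: segment_compact.
Qed.

Lemma dmassE I : (dmass I)%:E = mu (ditv I).
Proof. by rewrite fineK // ge0_fin_numE// mu_ditv_lty. Qed.

Lemma dmass_gt0 I : 0 < dmass I.
Proof. by rewrite -lte_fin dmassE. Qed.

Lemma le_dmass I J : ditv I `<=` ditv J -> dmass I <= dmass J.
Proof.
move=> IJ; rewrite -lee_fin !dmassE le_measure// inE; exact: measurable_ditv.
Qed.

Lemma dmass_halves I : dmass I = dmass (dleft I) + dmass (dright I).
Proof.
apply: EFin_inj; rewrite EFinD !dmassE (ditv_halves R I) measureU//.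
- exact: measurable_ditv.
- exact: measurable_ditv.
- by rewrite -subset0 => x [/ditv_halves_disj].
Qed.

Lemma dmin_gt0 I : 0 < dmin I.
Proof. by rewrite lt_min !dmass_gt0. Qed.

(** * Size and cancellation of Haar functions *)

Definition haar_coef I :=
  Num.sqrt (dmass (dleft I) * dmass (dright I) / dmass I).

Lemma haarE I : haar I = fun x =>
  haar_coef I / dmass (dleft I) * \1_(ditv (dleft I)) x +
  - (haar_coef I / dmass (dright I)) * \1_(ditv (dright I)) x.
Proof. by apply/funext => x; rewrite /Defs.haar /haar_coef; ring. Qed.

Lemma haar_left I x : ditv (dleft I) x -> haar I x = haar_coef I / dmass (dleft I).
Proof.
move=> xl; rewrite haarE !indicE mem_set// memNset ?mulr1 ?mulr0 ?addr0//.
by move/(ditv_halves_disj xl).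
Qed.

Lemma haar_right I x :
  ditv (dright I) x -> haar I x = - (haar_coef I / dmass (dright I)).
Proof.
move=> xr; rewrite haarE !indicE [in X in _ + X]mem_set// memNset ?mulr1 ?mulr0 ?add0r//.
by move/ditv_halves_disj; exact.
Qed.

Lemma haar_out I x : ~ ditv I x -> haar I x = 0.
Proof.
rewrite (ditv_halves R I) => /not_orP[nl nr].
by rewrite haarE !indicE !memNset// !mulr0 addr0.
Qed.

Lemma measurable_haar I : measurable_fun [set: measurableTypeR R] (haar I).
Proof.
rewrite haarE; apply: measurable_funD; apply: measurable_funM => //;
  by apply: measurable_indic; exact: measurable_ditv.
Qed.

Lemma sqr_haar_coef I :
  haar_coef I ^+ 2 = dmass (dleft I) * dmass (dright I) / dmass I.
Proof. by rewrite sqr_sqrtr// ltW// divr_gt0 ?mulr_gt0 ?dmass_gt0. Qed.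

(** With a, b the masses of the halves, the value of h_I^2 on the half of mass a
    is ab/(a+b)/a^2 = b/((a+b)a), which is at most 1/a and, when a <= b, at
    least 1/(2a). *)
Lemma sqr_haar_le I x : haar I x ^+ 2 <= (dmin I)^-1.
Proof.
have l0 := dmass_gt0 (dleft I); have r0 := dmass_gt0 (dright I).
have [|nI] := pselect (ditv I x); last first.
  by rewrite haar_out// expr0n/= invr_ge0 ltW// dmin_gt0.
have key (a b : R) : 0 < a -> 0 < b -> a * b / (a + b) / a ^+ 2 <= (Num.min a b)^-1.
  move=> a0 b0; have -> : a * b / (a + b) / a ^+ 2 = b / ((a + b) * a).
    by field; rewrite !gt_eqF// addr_gt0.
  rewrite ler_pdivrMr ?mulr_gt0 ?addr_gt0// ler_pdivlMl ?lt_min ?a0//.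
  rewrite minEle; case: ifP => ab; nra.
rewrite (ditv_halves R I) => -[/haar_left|/haar_right] ->.
  by rewrite expr_div_n sqr_haar_coef (dmass_halves I); exact: key.
rewrite sqrrN expr_div_n sqr_haar_coef (dmass_halves I) /Defs.dmin minC addrC.
by rewrite [X in X / _ / _]mulrC key.
Qed.

(** H is the lighter half of I. *)
Lemma sqr_haar_ge I : exists2 H, dparent H = I /\ dmass H = dmin I &
  forall x, ditv H x -> (2 * dmin I)^-1 <= haar I x ^+ 2.
Proof.
have l0 := dmass_gt0 (dleft I); have r0 := dmass_gt0 (dright I).
have key (a b : R) : 0 < a -> a <= b -> (2 * a)^-1 <= a * b / (a + b) / a ^+ 2.
  move=> a0 ab; have b0 : 0 < b by lra.
  have -> : a * b / (a + b) / a ^+ 2 = b / ((a + b) * a).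
    by field; rewrite !gt_eqF// addr_gt0.
  rewrite ler_pdivlMr ?mulr_gt0 ?addr_gt0// ler_pdivrMl ?mulr_gt0//.
  nra.
rewrite /Defs.dmin minEle; case: ifPn => [ab|].
  exists (dleft I); first by rewrite dparent_dsub.
  move=> x /haar_left ->.
  by rewrite expr_div_n sqr_haar_coef (dmass_halves I) key.
rewrite -ltNge => /ltW ab; exists (dright I); first by rewrite dparent_dsub.
move=> x /haar_right ->.
rewrite sqrrN expr_div_n sqr_haar_coef (dmass_halves I) addrC.
by rewrite [X in _ <= X / _ / _]mulrC key.
Qed.

(** Each half of J either contains I or misses it once I is finer than J. *)
Lemma haar_localized J I : (I.1 <= J.1 /\ ditv J `<=` ditv I) \/
  exists v, forall x, ditv I x -> haar J x = v.
Proof.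
have [JI|IJ] := leP I.1 J.1.
  have [[z [zI zJ]]|nIJ] := pselect (exists z, ditv I z /\ ditv J z).
    by left; split=> // y; exact: (ditv_nested JI zI zJ).
  right; exists 0 => x xI; apply: haar_out => xJ; apply: nIJ; by exists x.
right; have [z zI] := ditv_nonempty R I; exists (haar J z) => x xI.
have half s : ditv (dsub 1 s J) z <-> ditv (dsub 1 s J) x.
  have le1 : (dsub 1 s J).1 <= I.1 by rewrite /=; lia.
  by split=> [zh|xh]; [exact: (ditv_nested le1 zh zI)|exact: (ditv_nested le1 xh xI)].
have ind s : \1_(ditv (dsub 1 s J)) z = \1_(ditv (dsub 1 s J)) x :> R.
  by rewrite !indicE; congr (_%:R); congr nat_of_bool; apply/idP/idP; rewrite !inE => /half.
by rewrite !haarE /dleft /dright !ind.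
Qed.

Lemma integrable_indic_ditv (D : set (measurableTypeR R)) K : measurable D ->
  mu.-integrable D (EFin \o \1_(ditv K)).
Proof.
move=> mD; apply/integrableP; split.
  by apply/measurable_EFinP; apply: measurable_indic; exact: measurable_ditv.
under eq_integral do rewrite /= ger0_norm ?indicE//=.
rewrite (integral_indic mu mD (measurable_ditv K)).
apply: le_lt_trans (mu_ditv_lty K); rewrite le_measure ?inE//.
- by apply: measurableI => //; exact: measurable_ditv.
- exact: measurable_ditv.
Qed.

Lemma Rintegral_halves (D : set (measurableTypeR R)) J a b :
  measurable D -> ditv J `<=` D ->
  \int[mu]_(x in D) (a * \1_(ditv (dleft J)) x + b * \1_(ditv (dright J)) x) =
  a * dmass (dleft J) + b * dmass (dright J).
Proof.
move=> mD JD.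
have int_ind K : ditv K `<=` D -> \int[mu]_(x in D) \1_(ditv K) x = dmass K.
  move=> KD; rewrite /Rintegral (integral_indic mu mD (measurable_ditv K)).
  by rewrite setIidl.
have [lD rD] : ditv (dleft J) `<=` D /\ ditv (dright J) `<=` D.
  by split=> x xh; apply: JD; rewrite (ditv_halves R J); [left|right].
have intZ c K : mu.-integrable D (EFin \o (fun x => c * \1_(ditv K) x)).
  have -> : EFin \o (fun x => c * \1_(ditv K) x) =
            (fun x => c%:E * (\1_(ditv K) x)%:E)%E by apply/funext.
  by apply: integrableZl => //; exact: integrable_indic_ditv.
rewrite RintegralD// !RintegralZl ?int_ind//; exact: integrable_indic_ditv.
Qed.

Lemma haar_average I J : ditv J `<=` ditv I -> avg mu (haar J) I = 0.
Proof.
move=> JI; rewrite /avg haarE Rintegral_halves//; last exact: measurable_ditv.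
by rewrite mulNr !mulfVK ?subrr ?mulr0// gt_eqF// dmass_gt0.
Qed.

Lemma inner_haar J : inner mu (haar J) (haar J) = 1.
Proof.
have l0 := dmass_gt0 (dleft J); have r0 := dmass_gt0 (dright J).
have sq : (fun x => haar J x * haar J x) = fun x =>
    (haar_coef J / dmass (dleft J)) ^+ 2 * \1_(ditv (dleft J)) x +
    (haar_coef J / dmass (dright J)) ^+ 2 * \1_(ditv (dright J)) x.
  apply/funext => x; rewrite haarE !indicE.
  have [xl|nl] := pselect (ditv (dleft J) x).
    by rewrite (mem_set xl) memNset => [|/(ditv_halves_disj xl)//] /=; ring.
  by rewrite (memNset nl) /=; case: (_ \in _) => /=; ring.
rewrite /inner sq Rintegral_halves// !expr_div_n sqr_haar_coef (dmass_halves J).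
field; rewrite !gt_eqF// addr_gt0//.
Qed.

Lemma norm_haar_le J x : `|haar J x| <= Num.sqrt (dmin J)^-1.
Proof.
by rewrite -[leLHS]sqrtr_sqr ler_sqrt ?sqr_haar_le// invr_ge0 ltW// dmin_gt0.
Qed.

(** * Shifts with a single nonzero coefficient *)

Lemma Lfun2_bounded (f : measurableTypeR R -> R) (I : dyadic) (c : R) :
  measurable_fun [set: measurableTypeR R] f -> (forall x, `|f x| <= c) ->
  (forall x, ~ ditv I x -> f x = 0) -> f \in Lfun mu 2%:E.
Proof.
move=> mf fc f0; rewrite inE; apply/andP; split; rewrite inE//=.
have c0 : 0 <= c by apply: le_trans (fc 0).
rewrite /finite_norm unlock /=; apply: poweR_lty.
apply: (@le_lt_trans _ _ (\int[mu]_x (c `^ 2 * \1_(ditv I) x)%:E)%E).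
  apply: ge0_le_integral => //=.
  - apply/measurable_EFinP.
    apply: (@measurableT_comp _ _ _ _ _ _ (fun x : R => x `^ 2)%R) => //.
    exact: measurableT_comp.
  - apply/measurable_EFinP; apply: measurable_funM => //.
    by apply: measurable_indic; exact: measurable_ditv.
  - move=> x _; rewrite lee_fin indicE.
    have [xI|nI] := pselect (ditv I x); last first.
      by rewrite f0// normr0 powR0// memNset// mulr0.
    by rewrite mem_set// mulr1 ge0_ler_powR// nnegrE.
under eq_integral do rewrite EFinM.
rewrite integralZl//; last exact: integrable_indic_ditv.
rewrite (integral_indic mu measurableT (measurable_ditv I)) setIT -dmassE.
by rewrite -EFinM ltry.
Qed.

Lemma Lfun2_haar_restrict I J : haar J \_ (ditv I) \in Lfun mu 2%:E.
Proof.
apply: (@Lfun2_bounded _ J (Num.sqrt (dmin J)^-1)).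
- apply/(measurable_restrictT (haar J) (measurable_ditv I)).
  by apply: measurable_funTS; exact: measurable_haar.
- move=> x; rewrite patchE; case: ifP => _; first exact: norm_haar_le.
  by rewrite normr0 sqrtr_ge0.
- by move=> x nJ; rewrite patchE haar_out// if_same.
Qed.

(** The partial sums over finite sets containing I are all equal to the limit. *)
Lemma single_term_shift_L2 m n s t I (f : R -> R) : f \in Lfun mu 2%:E ->
  is_shift_L2 mu m n s t (fun J => (J == I)%:R) f
    (fun x => inner mu f (haar (dsub m s I)) * haar (dsub n t I) x).
Proof.
move=> f2; split=> //.
  apply: (@Lfun2_bounded _ (dsub n t I)
    (`|inner mu f (haar (dsub m s I))| * Num.sqrt (dmin (dsub n t I))^-1)).
  - by apply: measurable_funM => //; exact: measurable_haar.
  - by move=> x; rewrite normrM ler_wpM2l// norm_haar_le.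
  - by move=> x /haar_out ->; rewrite mulr0.
apply: cvg_near_cst; first exact: (@filter_filter _ _ totally_filter).
exists [fset I]%fset => // J /= IJ.
rewrite [X in Lnorm _ _ X](_ : _ = cst 0%E) ?Lnorm0//.
apply/funext => x /=; congr EFin; apply/eqP; rewrite subr_eq0; apply/eqP.
have IJ' : I \in J by rewrite -fsub1set.
rewrite /shift_sum (big_fsetD1 I)//= eqxx mul1r big1_seq ?addr0// => K /=.
by rewrite !inE => /andP[/negPf -> _]; rewrite !mul0r.
Qed.

(** On I0 the shift of h_J and that of its restriction to A, the (m + n)-th
    ancestor of I0, must differ by a constant.  If h_J' is constant on I0 this is
    clear.  Otherwise J' lies in I0, the hypothesis on J puts J inside A, and the
    restriction does not change h_J. *)
Lemma single_term_shift_haar m n s t I :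
  let J := dsub m s I in let J' := dsub n t I in
  ditv J `<=` ditv (dancestor (m + n) J') ->
  is_shift mu m n s t (fun J => (J == I)%:R) (haar J) (haar J').
Proof.
move=> J J' sJ; split; first exact: measurable_haar.
move=> I0; set A := dancestor (m + n) I0.
exists (fun x => inner mu (haar J \_ (ditv A)) (haar J) * haar J' x).
  by apply: single_term_shift_L2; exact: Lfun2_haar_restrict.
have [[lI0 J'I0]|[v vJ']] := haar_localized J' I0; last first.
  exists (v - inner mu (haar J \_ (ditv A)) (haar J) * v).
  by apply: aeW => x xI0; rewrite vJ'.
have JA : ditv J `<=` ditv A.
  (* A and the (m + n)-th ancestor of J' share a point of J', and A is coarser. *)
  move=> y /sJ yJ'; have [z zJ'] := ditv_nonempty R J'.
  have zA : ditv A z by apply: ditv_ancestor; exact: J'I0.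
  apply: (ditv_nested _ zA (ditv_ancestor (m + n) zJ') yJ').
  by rewrite !dancestor_level; lia.
exists 0; apply: aeW => x _.
rewrite [X in inner mu X](_ : _ = haar J) ?inner_haar ?mul1r ?subrr//.
apply/funext => y; rewrite patchE; case: ifPn => // /negP.
rewrite inE => nA; rewrite haar_out// => /JA; exact: nA.
Qed.

(** * Norms of Haar functions *)

Lemma integral_le_cst (D : set (measurableTypeR R)) (f : R -> R) c :
  measurable D -> measurable_fun D f -> (forall x, D x -> 0 <= f x <= c) ->
  (\int[mu]_(x in D) (f x)%:E <= c%:E * mu D)%E.
Proof.
move=> mD mf fc; rewrite -integral_cst//; apply: ge0_le_integral => //.
- by move=> x /fc /andP[]; rewrite lee_fin.
- exact/measurable_EFinP.
- by move=> x /fc /andP[_] fxc; rewrite lee_fin.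
Qed.

Lemma integral_ge_cst (D : set (measurableTypeR R)) (f : R -> R) c :
  measurable D -> measurable_fun D f -> 0 <= c -> (forall x, D x -> c <= f x) ->
  (c%:E * mu D <= \int[mu]_(x in D) (f x)%:E)%E.
Proof.
move=> mD mf c0 cf; rewrite -integral_cst//; apply: ge0_le_integral => //.
exact/measurable_EFinP.
Qed.

Lemma avg_itv (a b : R) I (f : R -> R) : measurable_fun (ditv I : set (measurableTypeR R)) f ->
  0 <= a -> (forall x, ditv I x -> a <= f x <= b) -> a <= avg mu f I <= b.
Proof.
move=> mf a0 fab; have mI := measurable_ditv I.
have lo := integral_ge_cst mI mf a0 (fun x xI => proj1 (andP (fab x xI))).
have up : (\int[mu]_(x in ditv I) (f x)%:E <= b%:E * mu (ditv I))%E.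
  by apply: integral_le_cst => // x /fab /andP[/(le_trans a0) -> ->].
rewrite -dmassE in lo up.
have fin : (\int[mu]_(x in ditv I) (f x)%:E)%E \is a fin_num.
  rewrite ge0_fin_numE ?(le_lt_trans up) -?EFinM ?ltry//.
  by apply: le_trans lo; rewrite -EFinM lee_fin mulr_ge0// ltW// dmass_gt0.
have d0 := dmass_gt0 I.
rewrite /avg /Rintegral ler_pdivlMl// ler_pdivrMl// ![dmass I * _]mulrC.
by rewrite -!lee_fin fineK// !EFinM lo up.
Qed.

Lemma avg_cst I (f : R -> R) v : (forall x, ditv I x -> f x = v) -> avg mu f I = v.
Proof.
move=> fv; rewrite /avg (@eq_Rintegral _ _ _ mu _ (cst v)); last first.
  by move=> x; rewrite inE => /fv.
rewrite Rintegral_cst; last exact: measurable_ditv.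
by rewrite mulrCA mulVf ?mulr1// gt_eqF// dmass_gt0.
Qed.

Lemma sqrt_dminV J : Num.sqrt (dmin J)^-1 = dmin J `^ (- 2^-1).
Proof. by rewrite powRN powR12_sqrt ?sqrtrV// ltW// dmin_gt0. Qed.

(** The two alternatives are the two cases in which the norms are estimated: the
    difference vanishes on I, or it is h_J itself and I, a child of an interval
    containing J that meets J, contains a half of J. *)
Lemma haar_oscillation J I :
  (forall x, ditv I x -> haar J x - avg mu (haar J) (dparent I) = 0) \/
  [/\ forall x, ditv I x -> haar J x - avg mu (haar J) (dparent I) = haar J x &
      dmin J <= dmass I].
Proof.
have [[lI JI]|[v hv]] := haar_localized J (dparent I); last first.
  by left => x /ditv_parent xI; rewrite (avg_cst hv) hv// subrr.
rewrite haar_average//.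
have [[x [xI [s s2 xJ]]]|nIJ] := pselect (exists x, ditv I x /\
    exists2 s, (s < 2)%N & ditv (dsub 1 s J) x); last first.
  left => x xI; rewrite subr0 haar_out// (ditv_halves R J).
  by move=> [xl|xr]; apply: nIJ; exists x; split=> //; [exists 0%N|exists 1%N].
right; split; first by move=> *; rewrite subr0.
have JsI : ditv (dsub 1 s J) `<=` ditv I.
  move=> y; apply: (ditv_nested _ xI xJ) => /=.
  by rewrite /dparent /= in lI; lia.
apply: le_trans (le_dmass JsI); rewrite /Defs.dmin ge_min.
by case: s s2 {xJ JsI} => [|[|//]] _; rewrite lexx ?orbT.
Qed.

(** In the second case of [haar_oscillation] the term of I is at most
    mu(I)^(-1/2-alpha) (mu(I)/m(J))^(1/2) = mu(I)^(-alpha) m(J)^(-1/2), and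
    alpha >= 0 allows mu(I) to be replaced by the smaller m(J). *)
Lemma haar_Lambda2_norm_le alpha J : 0 <= alpha ->
  (Lambda2_norm mu alpha (haar J) <= (dmin J `^ (- (2^-1 + alpha)))%:E)%E.
Proof.
move=> alpha0; have m0 := dmin_gt0 J.
apply: ge_ereal_sup => _ [I _ <-].
have [osc|[osc mI]] := haar_oscillation J I.
  rewrite (@eq_integral _ _ _ mu _ (cst 0%E)); last first.
    by move=> x; rewrite inE => /osc ->; rewrite normr0 expr0n.
  by rewrite integral0 poweR0r ?invr_eq0// mule0 lee_fin powR_ge0.
rewrite (@eq_integral _ _ _ mu _ (fun x => (haar J x ^+ 2)%:E)); last first.
  by move=> x; rewrite inE => /osc ->; rewrite real_normK// num_real.
have up : (\int[mu]_(x in ditv I) (haar J x ^+ 2)%:E <= ((dmin J)^-1 * dmass I)%:E)%E.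
  rewrite EFinM dmassE; apply: integral_le_cst; first exact: measurable_ditv.
    by apply: measurable_funX; apply: measurable_funTS; exact: measurable_haar.
  by move=> x _; rewrite sqr_ge0 sqr_haar_le.
have d0 := dmass_gt0 I.
apply: (@le_trans _ _ ((dmass I `^ (- 2^-1 - alpha))%:E * ((dmin J)^-1 * dmass I)%:E `^ 2^-1)%E).
  apply: lee_wpmul2l; first by rewrite lee_fin powR_ge0.
  apply: gt0_ler_poweR => //; rewrite in_itv/= leey andbT.
    by apply: integral_ge0 => x _; rewrite lee_fin sqr_ge0.
  by rewrite lee_fin mulr_ge0// ?invr_ge0 ltW.
rewrite poweR_EFin -EFinM lee_fin powRM ?invr_ge0 ?(ltW m0) ?(ltW d0)//.
rewrite mulrCA -powRD ?(gt_eqF d0) ?implybT//.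
have -> : - 2^-1 - alpha + 2^-1 = - alpha by ring.
rewrite -powR_inv1 ?(ltW m0)// -powRrM mulN1r opprD powRD ?(gt_eqF m0) ?implybT//.
rewrite ler_wpM2l ?powR_ge0// !powRN lef_pV2 ?posrE ?powR_gt0//.
by rewrite ge0_ler_powR// nnegrE ltW.
Qed.

(** The supremum is tested on the lighter half of J. *)
Lemma haar_Lambda2_norm_ge alpha J :
  ((2^-1 `^ 2^-1 * dmin J `^ (- (2^-1 + alpha)))%:E <= Lambda2_norm mu alpha (haar J))%E.
Proof.
have m0 := dmin_gt0 J; have [H [HJ mH] hH] := sqr_haar_ge J.
apply: le_trans (ereal_sup_ubound _); last by exists H.
rewrite HJ haar_average// mH mulrC EFinM opprD.
apply: lee_wpmul2l; first by rewrite lee_fin powR_ge0.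
rewrite -poweR_EFin; apply: gt0_ler_poweR => //; rewrite ?in_itv/= ?leey ?andbT.
- by rewrite lee_fin.
- by apply: integral_ge0 => x _; rewrite lee_fin exprn_ge0.
have -> : 2^-1 = (2 * dmin J)^-1 * dmin J by field; rewrite gt_eqF.
rewrite EFinM -[in X in (_ * X <= _)%E]mH dmassE; apply: integral_ge_cst.
- exact: measurable_ditv.
- apply: measurable_funX; apply: measurableT_comp => //; apply: measurable_funB => //.
  by apply: measurable_funTS; exact: measurable_haar.
- by rewrite invr_ge0 mulr_ge0// ltW.
- by move=> x /hH; rewrite subr0 real_normK// num_real.
Qed.

(** On an interval of level k the conditional expectation of level k - 1 is the
    constant average over its parent. *)
Lemma condE_abs_oscillation (f : R -> R) k x :
  condE mu k (fun y => `|f y - condE mu (k - 1) f y|) x =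
  avg mu (fun y => `|f y - avg mu f (dparent (dyadic_at k x))|) (dyadic_at k x).
Proof.
rewrite /condE /avg; congr (_ * _); apply: eq_Rintegral => y.
by rewrite inE => /ditvE /= yx; rewrite -dyadic_at_parent yx.
Qed.

Lemma measurable_haar_oscillation I J c :
  measurable_fun (ditv I : set (measurableTypeR R)) (fun y => `|haar J y - c|).
Proof.
apply: measurableT_comp => //; apply: measurable_funB => //.
by apply: measurable_funTS; exact: measurable_haar.
Qed.

Lemma mu_setT_gt0 : (0 < mu [set: R])%E.
Proof.
apply: lt_le_trans (mu_dyadic_gt0 (0, 0)) _; apply: le_measure => //; rewrite inE//.
exact: measurable_ditv.
Qed.

Lemma haar_BMO_norm_le J : (BMO_norm mu (haar J) <= (dmin J `^ (- 2^-1))%:E)%E.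
Proof.
apply: ge_ereal_sup => _ [k _ <-]; rewrite unlock mu_setT_gt0.
apply/ess_supP; apply: aeW => x /=; rewrite lee_fin condE_abs_oscillation.
set I := dyadic_at k x.
have /andP[a0 aS] : 0 <= avg mu (fun y => `|haar J y - avg mu (haar J) (dparent I)|) I <=
    dmin J `^ (- 2^-1).
  apply: avg_itv => //; first exact: measurable_haar_oscillation.
  move=> y yI; rewrite normr_ge0/=.
  have [osc|[osc _]] := haar_oscillation J I; rewrite osc//.
    by rewrite normr0 powR_ge0.
  by rewrite -sqrt_dminV norm_haar_le.
by rewrite ger0_norm.
Qed.

Lemma Lnormy_ge (f : R -> R) v I : (forall x, ditv I x -> v <= `|f x|) ->
  (v%:E <= 'N[mu]_+oo[EFin \o f])%E.
Proof.
move=> vf; rewrite unlock mu_setT_gt0 leNgt; apply/negP => lt_v.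
have null : mu.-negligible (ditv I).
  apply: negligibleS (ess_sup_ge mu (abse \o (EFin \o f))) => x /vf vx /=.
  by apply/negP; rewrite -ltNge (lt_le_trans lt_v)// lee_fin.
have := mu_dyadic_gt0 I; move/(negligibleP _ (measurable_ditv I)): null => ->.
by rewrite ltxx.
Qed.

(** The lighter half of J has positive mass and the conditional expectation of
    its level is large on all of it, so the essential supremum sees it. *)
Lemma haar_BMO_norm_ge J :
  ((2^-1 `^ 2^-1 * dmin J `^ (- 2^-1))%:E <= BMO_norm mu (haar J))%E.
Proof.
have m0 := dmin_gt0 J; have [H [HJ mH] hH] := sqr_haar_ge J.
apply: le_trans (ereal_sup_ubound _); last by exists H.1.
apply: (@Lnormy_ge _ _ H) => x /ditvE xH.
rewrite condE_abs_oscillation xH HJ haar_average//.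
have -> : 2^-1 `^ 2^-1 * dmin J `^ (- 2^-1) = Num.sqrt (2 * dmin J)^-1.
  by rewrite powR12_sqrt// -sqrt_dminV -sqrtrM// invfM.
have /andP[ca _] : Num.sqrt (2 * dmin J)^-1 <= avg mu (fun y => `|haar J y - 0|) H
    <= Num.sqrt (dmin J)^-1.
  apply: avg_itv; [exact: measurable_haar_oscillation|exact: sqrtr_ge0|].
  move=> y yH; rewrite subr0 norm_haar_le andbT -sqrtr_sqr.
  by rewrite ler_sqrt ?sqr_ge0// hH.
by apply: le_trans (ler_norm _).
Qed.

Lemma compact_integral_lty (K : set R) (f : R -> R) c : compact K ->
  measurable_fun [set: measurableTypeR R] f -> (forall x, 0 <= f x <= c) ->
  (\int[mu]_(x in K) (f x)%:E < +oo)%E.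
Proof.
move=> cK mf fc; have mK : measurable (K : set (measurableTypeR R)).
  by apply: closed_measurable; exact: compact_closed.
have := locally_finite_compact mu_locally_finite cK.
rewrite -ge0_fin_numE// => /fineK Kfin.
have /le_lt_trans : (\int[mu]_(x in K) (f x)%:E <= c%:E * mu K)%E.
  by apply: integral_le_cst => //; exact: measurable_funTS.
by apply; rewrite -Kfin -EFinM ltry.
Qed.

Lemma haar_Lambda2 alpha J : 0 <= alpha -> Lambda2 mu alpha (haar J).
Proof.
move=> alpha0; split; last exact: le_lt_trans (haar_Lambda2_norm_le J alpha0) (ltry _).
split; first exact: measurable_haar.
move=> K cK; apply: (@compact_integral_lty _ _ (dmin J)^-1 cK).
  by apply: measurable_funX; apply: measurableT_comp => //; exact: measurable_haar.
by move=> x; rewrite sqr_ge0/= real_normK ?num_real// sqr_haar_le.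
Qed.

Lemma haar_BMO J : BMO mu (haar J).
Proof.
split; last exact: le_lt_trans (haar_BMO_norm_le J) (ltry _).
split; first exact: measurable_haar.
move=> K cK; apply: (@compact_integral_lty _ _ (Num.sqrt (dmin J)^-1) cK).
  by apply: measurableT_comp => //; exact: measurable_haar.
by move=> x; rewrite normr_ge0 norm_haar_le.
Qed.

(** * Testing on Haar functions *)

Section HaarTestFunctions.
Variables (X : set (R -> R)) (normX : (R -> R) -> \bar R) (p c0 : R).
Hypotheses (p0 : 0 < p) (c0_gt0 : 0 < c0).
Hypothesis haarX : forall J, X (haar J).
Hypothesis norm_haar_lb : forall J, ((c0 * dmin J `^ (- p))%:E <= normX (haar J))%E.
Hypothesis norm_haar_ub : forall J, (normX (haar J) <= (dmin J `^ (- p))%:E)%E.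
Hypothesis shifts_bounded : shifts_uniformly_bounded mu X normX.

(** Applying the bound to the shift that sends h_J to h_J', with J = I_m^s and
    J' = I_n^t, gives c0 m(J')^(-p) <= C m(J)^(-p), to be raised to the power -1/p. *)
Lemma dmin_compare m n s t : (s < 2 ^ m)%N -> (t < 2 ^ n)%N ->
  (forall I, ditv (dsub m s I) `<=` ditv (dancestor (m + n) (dsub n t I))) ->
  exists2 K, 0 <= K & forall I, dmin (dsub m s I) <= K * dmin (dsub n t I).
Proof.
move=> sm tn anc; have [C normT] := shifts_bounded sm tn.
exists ((`|C| / c0) `^ p^-1); first exact: powR_ge0.
move=> I; set J := dsub m s I; set J' := dsub n t I.
have a1 K : `|(K == I)%:R| <= 1 :> R by rewrite normr_nat lern1 leq_b1.
have := normT _ a1 _ _ (haarX J) (single_term_shift_haar (anc I)).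
move=> /(le_trans (norm_haar_lb J')) TJ.
have {}TJ : c0 * dmin J' `^ (- p) <= `|C| * dmin J `^ (- p).
  rewrite -lee_fin; apply: le_trans TJ _; rewrite EFinM.
  have N0 : (0 <= normX (haar J))%E.
    apply: le_trans (norm_haar_lb J).
    by rewrite lee_fin mulr_ge0 ?powR_ge0// ltW.
  (* The upper bound for the norm may only be multiplied by a nonnegative
     constant, which C need not be. *)
  apply: (@le_trans _ _ (`|C|%:E * normX (haar J))%E).
    by apply: lee_wpmul2r => //; rewrite lee_fin ler_norm.
  by apply: lee_wpmul2l.
have [m0 m0'] := (dmin_gt0 J, dmin_gt0 J').
have {TJ} pow : dmin J `^ p <= `|C| / c0 * dmin J' `^ p.
  move: TJ; rewrite !powRN ler_pdivrMr ?powR_gt0// mulrAC ler_pdivlMr ?powR_gt0//.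
  by rewrite mulrAC ler_pdivlMr// mulrC.
have pK x : 0 < x -> x = (x `^ p) `^ p^-1.
  by move=> x0; rewrite -powRrM mulfV ?gt_eqF// powRr1// ltW.
rewrite (pK _ m0) [in leRHS](pK _ m0') -powRM ?powR_ge0//; last first.
  by rewrite divr_ge0// ltW.
apply: ge0_ler_powR => //; rewrite ?nnegrE ?invr_ge0 ?(ltW p0) ?powR_ge0//.
by rewrite mulr_ge0 ?powR_ge0// divr_ge0// ltW.
Qed.

Lemma dsub0 I : dsub 0 0 I = I.
Proof. by case: I => k l; rewrite /dsub/= expn0; congr pair; lia. Qed.

(** Every interval is a child P_s of its parent P.  The shifts h_P -> h_(P_s) give
    m(P) <= K m(P_s), and the shifts h_(P_s) -> h_P the reverse inequality. *)
Lemma bounded_on_haar_balanced : balanced mu.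
Proof.
have up s : (s < 2)%N -> exists2 K, 0 <= K &
    forall P, dmin P <= K * dmin (dsub 1 s P).
  move=> s2; have [||P|K K0 le_K] := @dmin_compare 0 1 0 s => //.
    by rewrite dsub0 /= dparent_dsub.
  by exists K => // P; have := le_K P; rewrite dsub0.
have down s : (s < 2)%N -> exists2 K, 0 <= K &
    forall P, dmin (dsub 1 s P) <= K * dmin P.
  move=> s2; have [||P|K K0 le_K] := @dmin_compare 1 0 s 0 => //.
    rewrite dsub0 /= => x /ditv_parent; rewrite dparent_dsub//.
    exact: ditv_parent.
  by exists K => // P; have := le_K P; rewrite dsub0.
have [K1 K10 u0] := up 0 isT; have [K2 K20 u1] := up 1 isT.
have [K3 K30 d0] := down 0 isT; have [K4 K40 d1] := down 1 isT.
exists (1 + K1 + K2 + K3 + K4); first by lra.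
move=> I; have [s s2 {2 3}->] := dsub_dparent I; set P := dparent I.
have := dmin_gt0 (dsub 1 s P); have := dmin_gt0 P.
rewrite ler_pdivrMl; last by lra.
case: s s2 => [|[|//]] _.
  by move: (u0 P) (d0 P) => *; split; nra.
by move: (u1 P) (d1 P) => *; split; nra.
Qed.

End HaarTestFunctions.

End HaarFunctions.

Theorem proposition2p2 (R : realType)
    (mu : {measure set (measurableTypeR R) -> \bar R})
    (mu_locally_finite : locally_finite mu)
    (mu_dyadic_gt0 : forall I : dyadic, (0 < mu (ditv I))%E)
    (alpha : R) (alpha_gt0 : 0 < alpha) :
  (shifts_uniformly_bounded mu (Lambda2 mu alpha) (Lambda2_norm mu alpha) ->
     balanced mu) /\
  (shifts_uniformly_bounded mu (BMO mu) (BMO_norm mu) -> balanced mu).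
Proof.
have c0 : 0 < (2^-1 : R) `^ 2^-1 by rewrite powR_gt0.
have a0 := ltW alpha_gt0.
have p0 : 0 < 2^-1 + alpha by rewrite addr_gt0.
have half0 : 0 < 2^-1 :> R by rewrite invr_gt0.
split.
  apply: (bounded_on_haar_balanced mu_locally_finite mu_dyadic_gt0 p0 c0) => J.
  - exact: haar_Lambda2.
  - exact: haar_Lambda2_norm_ge.
  - exact: haar_Lambda2_norm_le.
apply: (bounded_on_haar_balanced mu_locally_finite mu_dyadic_gt0 half0 c0) => J.
- exact: haar_BMO.
- exact: haar_BMO_norm_ge.
- exact: haar_BMO_norm_le.
Qed.
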